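(* Let $k$ be a positive integer and let $G=(V,E)$ be a finite simple graph of order $n$ with chromatic number $h$. If \[ k > \frac{1}{1 - \left( 1 - \frac{1}{h} \right)^{h/n}}, \] then $\mu(G) \leqslant k-1$.
   Context: Let $G$ be a finite simple graph on the vertex set $\{1,\dots,n\}$ and let $\Gamma$ be a finite set of colors. A strategy for vertex $i$ is a function $F_i:\Gamma^n\to\Gamma$ whose value $F_i(x_1,\dots,x_n)$ depends only on those coordinates $x_j$ for which $j$ is adjacent to $i$ in $G$. A system of strategies $(F_1,\dots,F_n)$ is winning if for every $(x_1,\dots,x_n)\in\Gamma^n$ there is at least one $i$ with $F_i(x_1,\dots,x_n)=x_i$. The hat chromatic number $\mu(G)$ is the largest integer $k=|\Gamma|$ for which a winning system of strategies exists on $G$. *)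

(* Defs.v *)
From HB Require Import structures.
From mathcomp Require Import all_boot all_order all_algebra.
From mathcomp Require Import all_classical all_reals all_analysis.

Set Implicit Arguments.
Unset Strict Implicit.
Unset Printing Implicit Defensive.

Record simple_graph (V : finType) := SimpleGraph {
  adj :> rel V;
  adj_sym : symmetric adj;
  adj_irr : irreflexive adj }.

Section Coloring.
Variables (V : finType) (G : simple_graph V).

Definition proper_coloring (C : finType) (c : V -> C) : bool :=
  [forall u, forall v, G u v ==> (c u != c v)].

Definition colorable (h : nat) : bool :=
  [exists c : {ffun V -> 'I_h}, proper_coloring c].

Lemma colorable_exists : exists h, colorable h.
Proof.
exists #|V|; apply/existsP; exists [ffun v => enum_rank v].
apply/forallP=> u; apply/forallP=> v; apply/implyP=> Guv.
rewrite !ffunE; apply/negP => /eqP/enum_rank_inj uv.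
by move: Guv; rewrite uv adj_irr.
Qed.

Definition chromatic_number : nat := ex_minn colorable_exists.

End Coloring.

Section HatGame.
Variables (V : finType) (G : simple_graph V).

Definition is_strategy (Gamma : finType) (i : V)
    (f : {ffun V -> Gamma} -> Gamma) : Prop :=
  forall x y : {ffun V -> Gamma}, (forall j, G i j -> x j = y j) -> f x = f y.

Definition is_winning (Gamma : finType)
    (F : V -> {ffun V -> Gamma} -> Gamma) : Prop :=
  forall x : {ffun V -> Gamma}, exists i, F i x = x i.

Definition winnable (Gamma : finType) : Prop :=
  exists F : V -> {ffun V -> Gamma} -> Gamma,
    (forall i, is_strategy i (F i)) /\ is_winning F.

Definition is_largest_winnable (m : nat) : Prop :=
  winnable 'I_m /\ forall k, winnable 'I_k -> (k <= m)%N.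

(* The default 0 is only reached on the empty vertex set, where no number of
   colors is winnable; see is_largest_hat_chromatic_number below. *)
Definition hat_chromatic_number : nat := xget 0%N is_largest_winnable.

Lemma winnable_leq k : winnable 'I_k -> (k <= #|V|)%N.
Proof.
case: k => [//|k] [F [FS FW]]; set K := k.+1.
pose A i := [set x : {ffun V -> 'I_K} | F i x == x i]%SET.
pose upd i (p : {ffun V -> 'I_K} * 'I_K) : {ffun V -> 'I_K} :=
  [ffun j => if j == i then p.2 else p.1 j].
have Fupd i p : F i (upd i p) = F i p.1.
  by apply: FS => j Gij; rewrite ffunE; case: eqP Gij => // ->; rewrite adj_irr.
have cA i : (#|A i| * K <= #|{: {ffun V -> 'I_K}}|)%N.
  have -> : (#|A i| * K)%N = #|finset.setX (A i) [set: 'I_K]%SET|.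
    by rewrite cardsX cardsT card_ord.
  rewrite -(@card_in_imset _ _ (upd i)) ?max_card // => -[x c] [y d].
  rewrite !inE /= !andbT => /eqP Fx /eqP Fy E.
  have Exy : F i x = F i y by rewrite -(Fupd i (x, c)) -(Fupd i (y, d)) E.
  congr pair; last by have := congr1 (fun f : {ffun _ -> _} => f i) E;
    rewrite !ffunE eqxx.
  apply/ffunP=> j; have [->|ji] := eqVneq j i; first by rewrite -Fx -Fy.
  have := congr1 (fun f : {ffun _ -> _} => f j) E.
  by rewrite !ffunE (negPf ji).
have c0 : (0 < #|{: {ffun V -> 'I_K}}|)%N by apply/card_gt0P; exists [ffun=> ord0].
have cT : (#|{: {ffun V -> 'I_K}}| <= \sum_i #|A i|)%N.
  apply: (@leq_trans #|(\bigcup_i A i)%SET|).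
    apply: subset_leq_card; apply/fintype.subsetP=> x _.
    have [i Fi] := FW x; apply/finset.bigcupP; exists i => //.
    by rewrite inE Fi.
  elim/big_rec2: _ => [|i m B _ h]; first by rewrite cards0.
  by apply: leq_trans (leq_card_setU _ _) _; rewrite leq_add2l.
rewrite -(leq_pmul2l c0); apply: (@leq_trans (\sum_i #|A i| * K)%N).
  by rewrite -big_distrl /= leq_mul2r cT orbT.
apply: (@leq_trans (\sum_(i : V) #|{: {ffun V -> 'I_K}}|)%N).
  by apply: leq_sum => i _; exact: cA.
by rewrite sum_nat_const mulnC.
Qed.

Lemma is_largest_hat_chromatic_number :
  (0 < #|V|)%N -> is_largest_winnable hat_chromatic_number.
Proof.
move=> /card_gt0P[v _]; apply: (@xgetPex _ 0%N).
have ex1 : exists k, `[< winnable 'I_k >].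
  exists 1%N; apply/asboolP; exists (fun _ _ => ord0).
  by split=> // x; exists v; rewrite (ord1 (x v)).
have bd k : `[< winnable 'I_k >] -> (k <= #|V|)%N.
  by move=> /asboolP; exact: winnable_leq.
case: (ex_maxnP ex1 bd) => m /asboolP wm mx.
by exists m; split=> // k /asboolP; exact: mx.
Qed.

End HatGame.

(* Main.v *)
Require Import Defs.
From HB Require Import structures.
From mathcomp Require Import all_boot all_order all_algebra.
From mathcomp Require Import all_classical all_reals all_analysis.
Import Order.TTheory GRing.Theory Num.Theory.
Local Open Scope ring_scope.

(** The vertices of an independent set do not see each other, so once the hats
    outside it are fixed all its guesses are fixed, and with K colors they are
    all wrong for a proportion exactly (1 - 1/K)^s of the hat assignments, s
    being the size of the set. For a winning system and a proper coloring with
    classes of sizes n_1, ..., n_h, the union bound over the classes therefore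
    gives \sum_j (1 - (1 - 1/K)^n_j) >= 1, and AM-GM turns this into
    (1 - 1/K)^n <= (1 - 1/h)^h. *)

Section HatBound.
Variables (V : finType) (G : simple_graph V).

Definition all_wrong (Gamma : finType) (F : V -> {ffun V -> Gamma} -> Gamma)
    (S : {set V}) : {set {ffun V -> Gamma}} :=
  [set x | [forall i in S, F i x != x i]].

(** An injection proves the bound: colors are read in ['I_K.+1] as residues, and an all-wrong
    assignment is built from free hats outside [S] and a nonzero offset from the guess at each
    vertex of [S]. *)
Lemma card_all_wrong (K : nat) (F : V -> {ffun V -> 'I_K.+1} -> 'I_K.+1)
    (S : {set V}) :
  (forall i, is_strategy G i (F i)) ->
  (forall i j, i \in S -> j \in S -> ~~ G i j) ->
  (K ^ #|S| * K.+1 ^ (#|V| - #|S|) <= #|all_wrong _ F S|)%N.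
Proof.
move=> FS indep.
pose A i : {pred 'I_K.+1} := if i \in S then predC1 0 else predT.
pose shift (y : {ffun V -> 'I_K.+1}) : {ffun V -> 'I_K.+1} :=
  [ffun i => if i \in S then F i y + y i else y i].
(* By independence, a vertex of [S] sees only hats that [shift] leaves alone. *)
have Fshift i y : i \in S -> F i (shift y) = F i y.
  move=> iS; apply: FS => j Gij; rewrite ffunE; case: ifP => // jS.
  by move: (indep i j iS jS); rewrite Gij.
have -> : (K ^ #|S| * K.+1 ^ (#|V| - #|S|))%N
          = #|(family A : {pred {ffun V -> 'I_K.+1}})|.
  rewrite card_family foldrE big_map big_enum /=.
  rewrite (bigID (mem S)) /= -(cardsC S) addKn -!prod_nat_const; congr (_ * _)%N.
    by apply: eq_bigr => i iS; rewrite /A iS cardC1 card_ord.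
  apply: eq_big => [i|i]; rewrite inE // => /negPf iS.
  by rewrite /A iS card_ord.
(* The guesses on [S] can be read off [shift y], so subtracting them recovers [y]. *)
rewrite -(@card_in_imset _ _ shift) => [|x y _ _ E]; last first.
  apply/ffunP=> i; move/ffunP/(_ i): (E); rewrite !ffunE.
  case: ifP => // iS; rewrite -(Fshift i x iS) -(Fshift i y iS) E.
  exact: addrI.
apply: subset_leq_card; apply/fintype.subsetP=> _ /imsetP[y /familyP yA ->].
rewrite inE; apply/forall_inP => i iS.
have := yA i; rewrite Fshift // ffunE iS /A iS !inE.
by apply: contraNN; rewrite -subr_eq0 opprD addNKr oppr_eq0.
Qed.

Lemma winning_bound (R : realFieldType) (K h : nat) (c : V -> 'I_h) :
  proper_coloring G c -> winnable G 'I_K.+1 ->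
  (1 - K.+1%:R^-1) ^+ #|V| <= (1 - h%:R^-1) ^+ h :> R.
Proof.
move=> cP [F [FS FW]].
pose S j := [set i | c i == j].
pose q : R := 1 - K.+1%:R^-1.
pose N := #|{: {ffun V -> 'I_K.+1}}|.
have K0 : K.+1%:R != 0 :> R by rewrite pnatr_eq0.
have qE : q = K%:R / K.+1%:R.
  by apply: (mulIf K0); rewrite mulrBl divfK // mulVf // mul1r -natr1 addrK.
have q0 : 0 <= q by rewrite qE divr_ge0.
have NE : N = (K.+1 ^ #|V|)%N by rewrite /N card_ffun card_ord.
have N0 : 0 < N%:R :> R by rewrite NE ltr0n expn_gt0.
have wrong j : q ^+ #|S j| * N%:R <= #|all_wrong _ F (S j)|%:R.
  have /(card_all_wrong _ F) := FS; move/(_ (S j)).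
  have -> : q ^+ #|S j| * N%:R
      = (K ^ #|S j| * K.+1 ^ (#|V| - #|S j|))%N%:R.
    rewrite NE -{1}(subnKC (max_card (S j))) expnD !natrM !natrX.
    by rewrite mulrA qE expr_div_n divfK // expf_neq0.
  rewrite ler_nat; apply=> u v; rewrite !inE => /eqP cu /eqP cv.
  apply/negP => Guv; move/forallP/(_ u)/forallP/(_ v): cP.
  by rewrite Guv cu cv eqxx.
(* A vertex [i] guessing right on [x] puts [x] outside the all-wrong set of the class of [c i]. *)
have cover : (N <= \sum_(j < h) #|~: all_wrong _ F (S j)|)%N.
  apply: (@leq_trans #|(\bigcup_j ~: all_wrong _ F (S j))%SET|).
    apply: subset_leq_card; apply/fintype.subsetP=> x _.
    have [i Fi] := FW x; apply/finset.bigcupP; exists (c i) => //.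
    rewrite !inE; apply/negP => /forall_inP/(_ i).
    by rewrite inE eqxx Fi eqxx => /(_ isT).
  elim/big_rec2: _ => [|j m B _ IH]; first by rewrite cards0.
  by apply: leq_trans (leq_card_setU _ _) _; rewrite leq_add2l.
(* After scaling by [N]: each class splits the [N] assignments in two, so both families of sets
   together count [h * N]. *)
have sum_le : \sum_(j < h) q ^+ #|S j| <= h%:R - 1.
  rewrite -(ler_pM2r N0) mulr_suml mulrBl mul1r lerBrDl.
  apply: (@le_trans _ _ (\sum_(j < h) #|~: all_wrong _ F (S j)|%:R
                         + \sum_(j < h) #|all_wrong _ F (S j)|%:R)).
    by rewrite lerD ?ler_sum // -natr_sum ler_nat.
  rewrite -big_split /= (eq_bigr (fun=> N%:R)) => [|j _].
    by rewrite sumr_const card_ord mulr_natl.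
  by rewrite -natrD addnC cardsC.
have prodE : q ^+ #|V| = \prod_(j < h) q ^+ #|S j|.
  rewrite prodrXr; congr (_ ^+ _); rewrite -sum1_card.
  rewrite (partition_big c predT) //=; apply: eq_bigr => j _.
  by rewrite -sum1_card; apply: eq_bigl => i; rewrite inE.
(* The terms [q ^+ #|S j|] have product [q ^+ #|V|] and, by [sum_le], mean at most [1 - 1/h]. *)
have := leif_AGM (A := predT) (E := fun j : 'I_h => q ^+ #|S j|)
  (fun j _ => exprn_ge0 _ q0).
rewrite card_ord -prodE => /leif_le /le_trans; apply.
case: h => [|h] in c cP S wrong cover sum_le prodE *; first by rewrite !expr0.
have h0 : h.+1%:R != 0 :> R by rewrite pnatr_eq0.
rewrite lerXn2r ?nnegrE ?divr_ge0 ?sumr_ge0 //.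
- by move=> j _; exact: exprn_ge0.
- by rewrite subr_ge0 invf_le1 ?ler1n.
- by rewrite ler_pdivrMr ?ltr0n // mulrBl mulVf // mul1r.
Qed.

End HatBound.

Theorem theorem3 (R : realType) (V : finType) (G : simple_graph V)
    (n h k : nat) (hn : #|V| = n) (hh : chromatic_number G = h)
    (k_gt0 : (0 < k)%N)
    (hk : 1 / (1 - (1 - 1 / h%:R) `^ (h%:R / n%:R)) < k%:R :> R) :
  (hat_chromatic_number G <= k - 1)%N.
Proof.
(* If no largest value exists, the default 0 satisfies the bound trivially. *)
rewrite /hat_chromatic_number; case: xgetP => [m _ [wm _] | //].
rewrite subn1 -ltnS prednK // ltnNge; apply/negP => km.
have n0 : (0 < n)%N.
  by rewrite -hn; exact: leq_trans (leq_trans k_gt0 km) (winnable_leq wm).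
have [c cP] : exists c : {ffun V -> 'I_h}, proper_coloring G c.
  by rewrite -hh /chromatic_number; case: ex_minnP => d /existsP.
have h0 : (0 < h)%N.
  by move: n0; rewrite -hn => /card_gt0P[v _]; exact: leq_ltn_trans (ltn_ord (c v)).
case: m => [|K] in wm km *; first by rewrite leqNgt k_gt0 in km.
have := winning_bound _ _ R _ _ _ cP wm; rewrite hn.
move: hk; rewrite !div1r.
set p := 1 - h%:R^-1; set q := 1 - K.+1%:R^-1 => hk le_qp.
have p0 : 0 <= p by rewrite subr_ge0 invf_le1 ?ler1n ?ltr0n.
have q0 : 0 <= q by rewrite subr_ge0 invf_le1 ?ler1n ?ltr0n.
have nn0 : n%:R != 0 :> R by rewrite pnatr_eq0 -lt0n.
have e0 : 0 < h%:R / n%:R :> R by rewrite divr_gt0 ?ltr0n.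
(* This is the n-th root of [le_qp]. *)
have le_q : q <= p `^ (h%:R / n%:R).
  rewrite powRrM powR_mulrn //.
  have -> : q = (q ^+ n) `^ n%:R^-1.
    by rewrite -powR_mulrn // -powRrM mulfV // powRr1.
  by apply: ge0_ler_powR; rewrite ?nnegrE ?exprn_ge0 ?invr_ge0.
(* This makes the denominator in [hk] positive, so that the inequality can be inverted. *)
have lt1 : p `^ (h%:R / n%:R) < 1.
  rewrite [ltRHS](_ : _ = 1 `^ (h%:R / n%:R)); last by rewrite powR1.
  apply: gt0_ltr_powR => //.
  - by rewrite nnegrE.
  - by rewrite ltrBlDr ltrDl invr_gt0 ltr0n.
(* Inverting gives [1/(K+1) < 1 - p^(h/n)], that is [p^(h/n) < q], against [le_q]. *)
have := lt_le_trans hk (_ : k%:R <= K.+1%:R); rewrite ler_nat => /(_ km).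
rewrite invf_plt ?posrE ?ltr0n ?subr_gt0 //.
by rewrite ltrBrDr -ltrBrDl ltNge le_q.
Qed.
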